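(* Let $j\in\{1,w\}$, $E_0>0$, $X_0\in\mathbb R$, $y_0\in\mathbb R$, $t_0\in[0,T]$ be fixed and let $\phi(\hat x)=Q_j^{B_{E_0,X_0}}(t_0,y_0,e^{\hat x})$, $\hat x\in\mathbb R$. For $\hat x^*>0$ let $\phi_p^{\hat x^*}$ be the $8\hat x^*$-periodic odd-even extension of $\phi|_{[-\hat x^*,\hat x^*]}$ described in the context. Let $R_p^{\hat x^*}(\hat x,t)$ and $R(\hat x,t)$ be the solutions of $$\frac{\partial Q}{\partial t}+\Big(\alpha-\frac{\sigma^2}2\Big)\frac{\partial Q}{\partial\hat x}+\frac12\sigma^2\frac{\partial^2Q}{\partial\hat x^2}=0\qquad(\hat x\in\mathbb R,\ t\le t_0)$$ subject to $R_p^{\hat x^*}(\hat x,t_0)=\phi_p^{\hat x^*}(\hat x)$ and $R(\hat x,t_0)=\phi(\hat x)$, respectively. Let $L>0$ and $t\le t_0$. Then for any $\epsilon>0$ there exists $\hat x_\epsilon>0$ such that for all $\hat x^*\ge\hat x_\epsilon$ $$\big|R_p^{\hat x^*}(\hat x,t)-R(\hat x,t)\big|\le\epsilon,\qquad\hat x\in[-L,L].$$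
   Context: Extension. For $\hat x^*>0$ (with $[-L,L]\subset[-\hat x^*,\hat x^*]$), $\phi_p^{\hat x^*}(\hat x)=\phi(\hat x)$ if $\hat x\in[-\hat x^*,\hat x^*]$; $\phi_p^{\hat x^*}(\hat x)=2\phi(\hat x^* )-\phi(2\hat x^*-\hat x)$ if $\hat x\in[\hat x^*,3\hat x^*]$; $\phi_p^{\hat x^*}(\hat x)=\phi_p^{\hat x^*}(6\hat x^*-\hat x)$ if $\hat x\in[3\hat x^*,7\hat x^*]$; and it is extended to $\mathbb R$ periodically with period $8\hat x^*$. Solutions of the (backward, constant-coefficient) parabolic equation are the bounded ones, given for $t<t_0$ by convolution with the Gaussian kernel: the solution with terminal data $\psi$ at $t_0$ is $\int_{-\infty}^\infty\psi(\hat x')\Theta(\hat x',\hat x,t,t_0)d\hat x'$ with $\Theta=\frac1{\sigma\sqrt{2\pi(t_0-t)}}\exp\Big(-\frac{[\hat x'-(\hat x+(\alpha-\sigma^2/2)(t_0-t))]^2}{2\sigma^2(t_0-t)}\Big)$. Definition of $Q_j^{B_{E,X_0}}$. $(\Omega,\mathcal F,P)$ is a filtered probability space carrying a standard Brownian motion $z_t$. Constants: $r$ (risk-free rate), $\alpha$, $\sigma>0$, $\lambda\ge 0$, $0\le\mu<1$, $\gamma>0$, maturity $T>0$, strike $K>0$. The money in the bank $\bar X$, number of shares $\bar y\in\mathbb R$ and stock price $\bar S>0$ satisfy $$d\bar X=r\bar X\,dt-(1+\lambda)\bar S\,dL+(1-\mu)\bar S\,dM,\qquad d\bar y=dL-dM,\qquad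 d\bar S=\alpha\bar S\,dt+\sigma\bar S\,dz_t,$$ where a trading strategy $\pi=(L,M)$ is a pair of adapted, right-continuous, nonnegative, nondecreasing processes (here $L$ and $M$ denote the cumulative numbers of shares bought and sold); for a start at time $t$, $L(t^-)=M(t^-)=0$, but $L(t)$ or $M(t)$ may be positive, and the initial position $(\bar X,\bar y)=(X,y)$ is the position at $t^-$. The liquidation value is $c(y,S)=(1-\mu)Sy$ if $y\ge0$ and $c(y,S)=(1+\lambda)Sy$ if $y<0$. Terminal wealths: $W_1(T)=\bar X(T)+c(\bar y(T),\bar S(T))$; $W_w(T)=\bar X(T)+c(\bar y(T),\bar S(T))$ if $\bar S(T)<K$, and $W_w(T)=\bar X(T)+K+c(\bar y(T)-1,\bar S(T))$ if $\bar S(T)\ge K$. The utility is $U(x)=1-\exp(-\gamma x)$. For $E>0$, at time $t$, $$\mathscr E_E=\{(X,y,S)\in\mathbb R\times\mathbb R\times\mathbb R^+:\ (X+c(y-1,S))e^{r(T-t)}>-E\}.$$ Let $\tau(X,y)$ be the set of all trading strategies started from $(X,y)$. If at any time the state lies outside $\mathscr E_E$, the investor is automatically expelled from the market, is not allowed to return, and remains with the residual utility $1-\exp(\gamma E)$ in place of $U(W_j(T))$. With this rule, $$V_j^{B_E}(t,X,y,S)=\sup_{\pi\in\tau(X,y)}\mathbb E\{U(W_j(T))\mid(\bar X(t),\bar y(t),\bar S(t))=(X,y,S)\}\quad\text{if }(X,y,S)\in\mathscr E_E,$$ and $V_j^{B_E}(t,X,y,S)=1-\exp(\gamma E)$ otherwise.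 With $\delta(T,t)=e^{-r(T-t)}$, $Q_j^{B_{E,X_0}}$ is defined by $V_j^{B_E}(t,X_0,y,S)=1-\exp\left(-\gamma\frac{X_0}{\delta(T,t)}\right)Q_j^{B_{E,X_0}}(t,y,S)$. *)

(* Defs.v *)
From HB Require Import structures.
From mathcomp Require Import all_boot all_order all_algebra archimedean.
From mathcomp Require Import all_classical all_reals all_analysis.
From mathcomp Require Import lra.

Set Implicit Arguments.
Unset Strict Implicit.
Unset Printing Implicit Defensive.

Import Order.TTheory GRing.Theory Num.Theory.
Import numFieldNormedType.Exports.

Local Open Scope classical_set_scope.
Local Open Scope ring_scope.

Record market (R : realType) := Market {
  rate : R;        (* r *)
  drift : R;       (* alpha *)
  vol : R;         (* sigma *)
  buy_cost : R;    (* lambda *)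
  sell_cost : R;   (* mu *)
  risk_av : R;     (* gamma *)
  maturity : R;    (* T *)
  strike : R       (* K *)
}.

(* Without ([no_option], j = 1) or with ([writer], j = w) a short call. *)
Inductive position := no_option | writer.

Section deterministic.
Context {R : realType} (m : market R).

Definition liquidation (y S : R) : R :=
  if 0 <= y then (1 - sell_cost m) * S * y else (1 + buy_cost m) * S * y.

Definition terminal_wealth (j : position) (X y S : R) : R :=
  match j with
  | no_option => X + liquidation y S
  | writer => if S < strike m then X + liquidation y S
              else X + strike m + liquidation (y - 1) S
  end.

Definition utility (x : R) : R := 1 - expR (- (risk_av m * x)).

Definition region (E t : R) : set (R * R * R) :=
  [set q | 0 < q.2 /\
     - E < (q.1.1 + liquidation (q.1.2 - 1) q.2)
           * expR (rate m * (maturity m - t))].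

Definition residual_utility (E : R) : R := 1 - expR (risk_av m * E).

Definition discount (t : R) : R := expR (- (rate m * (maturity m - t))).

Definition Theta (x' x t t0 : R) : R :=
  (vol m * Num.sqrt (2 * pi * (t0 - t)))^-1
  * expR (- ((x' - (x + (drift m - vol m ^+ 2 / 2) * (t0 - t))) ^+ 2
             / (2 * vol m ^+ 2 * (t0 - t)))).

(* The bounded solution at (x, t), t <= t0, of
     dQ/dt + (alpha - sigma^2/2) dQ/dx + sigma^2/2 d^2Q/dx^2 = 0
   with terminal data psi at t0. *)
Definition parabolic_solution (psi : R -> R) (t0 x t : R) : R :=
  if t < t0
  then \int[lebesgue_measure]_(x' in [set: R]) (psi x' * Theta x' x t t0)
  else psi x.

End deterministic.

Section odd_even_extension.
Context {R : realType} (phi : R -> R) (a : R).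

(* Meaningful on [-a, 3a]. *)
Definition odd_ext (x : R) : R :=
  if x <= a then phi x else 2 * phi a - phi (2 * a - x).

(* Meaningful on [-a, 7a]. *)
Definition even_ext (x : R) : R :=
  if x <= 3 * a then odd_ext x else odd_ext (6 * a - x).

(* The argument is first translated by a multiple of 8a into [-a, 7a). *)
Definition periodic_ext (x : R) : R :=
  even_ext (x - 8 * a * (Num.floor ((x + a) / (8 * a)))%:~R).

End odd_even_extension.

Section odd_even_extension_spec.
Context {R : realType} (phi : R -> R) (a : R).
Hypothesis a_gt0 : 0 < a.
Local Notation phip := (periodic_ext phi a).

Lemma periodic_ext_periodic (x : R) : phip (x + 8 * a) = phip x.
Proof.
rewrite /periodic_ext.
have a8 : 8 * a != 0 by rewrite mulf_neq0// gt_eqF.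
have -> : (x + 8 * a + a) / (8 * a) = (x + a) / (8 * a) + 1%:~R.
  by rewrite addrAC mulrDl divff.
rewrite floorDrz ?intr_int// intrKfloor intrD.
by congr even_ext; rewrite mulrDr mulr1 opprD addrACA addrA; lra.
Qed.

Lemma periodic_ext_period (x : R) : - a <= x < 7 * a -> phip x = even_ext phi a x.
Proof.
have a0 := a_gt0; move=> /andP[xa xb]; rewrite /periodic_ext.
suff -> : Num.floor ((x + a) / (8 * a)) = 0 by rewrite mulr0 subr0.
apply/floor_def; rewrite add0r.
rewrite mulr0z mulr1z divr_ge0 ?ltr_pdivrMr; lra.
Qed.

Lemma periodic_ext_id (x : R) : - a <= x <= a -> phip x = phi x.
Proof.
have a0 := a_gt0; move=> /andP[xa xb].
have I : - a <= x < 7 * a by lra.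
rewrite (periodic_ext_period I) {I}.
have I : x <= 3 * a by lra.
by rewrite /even_ext /odd_ext I xb.
Qed.

Lemma periodic_ext_odd (x : R) :
  a <= x <= 3 * a -> phip x = 2 * phi a - phi (2 * a - x).
Proof.
have a0 := a_gt0; move=> /andP[xa xb].
have I : - a <= x < 7 * a by lra.
rewrite (periodic_ext_period I) {I}.
rewrite /even_ext xb /odd_ext; case: ifPn => // xa'.
have -> : x = a by lra.
by rewrite (_ : 2 * a - a = a); lra.
Qed.

Lemma periodic_ext_even (x : R) :
  3 * a <= x <= 7 * a -> phip x = phip (6 * a - x).
Proof.
have a0 := a_gt0; move=> /andP[xa]; rewrite le_eqVlt => /orP[/eqP ->|xb].
  have -> : 7 * a = - a + 8 * a by lra.
  by rewrite periodic_ext_periodic; congr periodic_ext; lra.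
have I1 : - a <= x < 7 * a by lra.
have I2 : - a <= 6 * a - x < 7 * a by lra.
have I3 : 6 * a - x <= 3 * a by lra.
rewrite !periodic_ext_period// /even_ext I3.
by case: ifPn => // x3a; congr odd_ext; lra.
Qed.

End odd_even_extension_spec.

Section stochastic.
Context {d : measure_display} {Omega : measurableType d} {R : realType}.
Variable P : probability Omega R.
Implicit Types (F : R -> set (set Omega)) (z X : R -> Omega -> R).

Record filtration F : Prop := Filtration {
  filtration_sigma : forall u : R, 0 <= u -> sigma_algebra setT (F u);
  filtration_sub : forall u : R, 0 <= u -> F u `<=` measurable;
  filtration_mono : forall u v : R, 0 <= u -> u <= v -> F u `<=` F v
}.

Definition adapted F (D : set R) X : Prop :=
  forall u : R, D u -> forall B : set R, measurable B -> F u (X u @^-1` B).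

Definition increment z (u v : R) (w : Omega) : R := z v w - z u w.

Record brownian F z : Prop := Brownian {
  brownian_adapted : adapted F `[0, +oo[ z;
  brownian0 : forall w, z 0 w = 0;
  brownian_continuous : forall w, {within `[0, +oo[, continuous (z ^~ w)};
  brownian_normal : forall u v : R, 0 <= u -> u < v ->
    forall B : set R, measurable B ->
    P (increment z u v @^-1` B) = normal_prob 0 (Num.sqrt (v - u)) B;
  brownian_indep : forall u v : R, 0 <= u -> u < v ->
    forall (A : set Omega) (B : set R), F u A -> measurable B ->
    P (A `&` increment z u v @^-1` B) = (P A * P (increment z u v @^-1` B))%E
}.

(* Sum of H(u_i) (z(u_{i+1}) - z(u_i)) over the partition a :: s. *)
Definition ito_sum (H z : R -> Omega -> R) (a : R) (s : seq R) (w : Omega) : R :=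
  \sum_(i < size s) H (nth a (a :: s) i) w
    * (z (nth a (a :: s) i.+1) w - z (nth a (a :: s) i) w).

(* [J] is the Ito integral of [H] with respect to [z] over [a, b]; for a
   continuous adapted integrand it is the limit in probability of the
   left-endpoint sums as the mesh of the partition tends to 0. *)
Definition is_ito_integral (H z : R -> Omega -> R) (a b : R) (J : Omega -> R) :
    Prop :=
  forall e : R, 0 < e -> exists2 delta : R, 0 < delta &
    forall s : seq R, itv_partition a b s ->
      (forall i, (i < size s)%N ->
         nth a (a :: s) i.+1 - nth a (a :: s) i < delta) ->
      (P [set w | (e < `|ito_sum H z a s w - J w|)%R] < e%:E)%E.

Section control.
Variables (m : market R) (F : R -> set (set Omega)) (z : R -> Omega -> R).
Local Notation T := (maturity m).

(* The paths of L and M are nondecreasing right-continuous functions on the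
   whole line vanishing before the starting time t. Hence L(t-) = 0, L >= 0,
   and the Lebesgue-Stieltjes measure dL has an atom of mass L(t) at t. *)
Record strategy (t : R) (L M : Omega -> cumulative R R) : Prop := Strategy {
  bought_before : forall w (u : R), u < t -> L w u = 0;
  sold_before : forall w (u : R), u < t -> M w u = 0;
  bought_adapted : adapted F `[t, T] (fun u w => L w u);
  sold_adapted : adapted F `[t, T] (fun u w => M w u)
}.

(* dS = alpha S dt + sigma S dz, S(t) = s *)
Record price_process (t s : R) (S : R -> Omega -> R) : Prop := PriceProcess {
  price_init : forall w, S t w = s;
  price_adapted : adapted F `[t, T] S;
  price_continuous : forall w, {within `[t, T], continuous (S ^~ w)};
  price_gt0 : forall w (u : R), t <= u <= T -> 0 < S u w;
  price_sde : exists2 J : R -> Omega -> R,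
    (forall u : R, t <= u <= T ->
       measurable_fun setT (J u) /\ is_ito_integral S z t u (J u)) &
    forall u : R, t <= u <= T -> {ae P, forall w,
      S u w = s + drift m * \int[lebesgue_measure]_(v in `[t, u]) S v w
              + vol m * J u w}
}.

(* dX = r X dt - (1 + lambda) S dL + (1 - mu) S dM,  dY = dL - dM, with
   (X, Y)(t-) = (x, y); the integrals against dL, dM include the jump at t. *)
Record holdings (t x y : R) (L M : Omega -> cumulative R R)
    (X Y S : R -> Omega -> R) : Prop := Holdings {
  cash_adapted : adapted F `[t, T] X;
  cash_integrable : forall w,
    lebesgue_measure.-integrable `[t, T] (EFin \o X ^~ w);
  cash_eq : forall w (u : R), t <= u <= T ->
    X u w = x + rate m * \int[lebesgue_measure]_(v in `[t, u]) X v w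
      - (1 + buy_cost m)
        * \int[lebesgue_stieltjes_measure (L w)]_(v in `[t, u]) S v w
      + (1 - sell_cost m)
        * \int[lebesgue_stieltjes_measure (M w)]_(v in `[t, u]) S v w;
  shares_eq : forall w (u : R), t <= u <= T -> Y u w = y + L w u - M w u
}.

Definition payoff (j : position) (E t : R) (X Y S : R -> Omega -> R)
    (w : Omega) : R :=
  if `[< forall u : R, t <= u <= T -> region m E u (X u w, Y u w, S u w) >]
  then utility m (terminal_wealth m j (X T w) (Y T w) (S T w))
  else residual_utility m E.

Definition expected_utilities (j : position) (E t x y s : R) : set (\bar R) :=
  [set e | exists L M X Y S,
     [/\ strategy t L M, price_process t s S, holdings t x y L M X Y S &
         e = ('E_P[payoff j E t X Y S])%E]].

Definition value (j : position) (E t x y s : R) : \bar R :=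
  if `[< region m E t (x, y, s) >]
  then ereal_sup (expected_utilities j E t x y s)
  else (residual_utility m E)%:E.

Definition Q (j : position) (E x0 t y s : R) : R :=
  (1 - fine (value j E t x0 y s)) / expR (- (risk_av m * (x0 / discount m t))).

Lemma value_Q (j : position) (E x0 t y s : R) :
  fine (value j E t x0 y s)
  = 1 - expR (- (risk_av m * (x0 / discount m t))) * Q j E x0 t y s.
Proof. by rewrite /Q mulrC divfK ?subKr// gt_eqF// expR_gt0. Qed.

End control.
End stochastic.

(* Main.v *)
Require Import Defs.
From mathcomp Require Import all_boot all_order all_algebra.
From mathcomp Require Import all_classical all_reals all_analysis.
From mathcomp Require Import ring lra.

Set Implicit Arguments.
Unset Strict Implicit.
Unset Printing Implicit Defensive.

Import Order.TTheory GRing.Theory Num.Theory.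
Import numFieldNormedType.Exports.

Import HBNNSimple.

Local Open Scope classical_set_scope.
Local Open Scope ring_scope.

(** The payoff is bounded: an investor never expelled has terminal wealth above
    [-E], so utilities lie in [1 - exp(gamma E), 1], and [phi] is bounded by
    some [C] and its extension by [3 C].  The two terminal data agree on
    [[-a, a]], hence the two solutions differ by at most a constant times the
    Gaussian mass outside [[-a, a]], which is O(exp(-kappa a^2)) uniformly for
    [x] in [[-L, L]].

    Nothing is known about the measurability of [phi] or of the payoffs.  The
    integral of a nonnegative function is a supremum over simple functions
    below it, hence a lower integral for a nonmeasurable one; lower integrals
    are monotone and additive over a measurable partition of the domain, which
    is all the argument needs. *)

(** * Lower integrals of functions that need not be measurable *)

Section lower_integral.
Context {d : measure_display} {T : measurableType d} {R : realType}.
Variable mu : measure T R.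
Local Open Scope ereal_scope.

Lemma ge0_le_lower_integral (f g : T -> \bar R) : (forall x, 0 <= f x) ->
  (forall x, f x <= g x) -> \int[mu]_x f x <= \int[mu]_x g x.
Proof.
move=> f0 fg; have g0 x : 0 <= g x by rewrite (le_trans (f0 x)).
rewrite !ge0_integralTE//; apply: ge_ereal_sup => _ [h hf <-].
by apply: ereal_sup_ubound; exists h => // x; rewrite (le_trans (hf x)).
Qed.

(** A simple function below [f] is the sum of its restrictions to [A] and to the complement of [A];
    both are simple, the first lies below [g] and the second below [k]. *)
Lemma lower_integral_le_add (A : set T) (f g k : T -> \bar R) :
  measurable A -> (forall x, 0 <= f x) -> (forall x, 0 <= g x) ->
  (forall x, 0 <= k x) ->
  (forall x, A x -> f x = g x) -> (forall x, ~ A x -> f x <= k x) ->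
  \int[mu]_x f x <= \int[mu]_x g x + \int[mu]_x k x.
Proof.
move=> mA f0 g0 k0 fg fk.
rewrite {1}ge0_integralTE//; apply: ge_ereal_sup => _ [h hf <-].
pose hA := proj_nnsfun h mA; pose hC := proj_nnsfun h (measurableC mA).
have hAE x : hA x = (h \_ A) x by rewrite (mrestrict h mA).
have hCE x : hC x = (h \_ (~` A)) x by rewrite (mrestrict h (measurableC mA)).
have hE : (h : T -> R) = (hA \+ hC)%R.
  apply/funext => x; rewrite -[RHS]/(hA x + hC x)%R hAE hCE !patchE in_setC.
  by case: (x \in A); rewrite ?addr0 ?add0r.
rewrite hE sintegralD -!integralT_nnsfun; apply: leeD.
  apply: ge0_le_lower_integral => x; rewrite ?lee_fin// hAE patchE.
  by case: ifPn => [/set_mem Ax|_] //; rewrite -fg//; exact: hf.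
apply: ge0_le_lower_integral => x; rewrite ?lee_fin// hCE patchE.
case: ifPn => [/set_mem Ax|_] //.
by rewrite (le_trans (hf x))// fk.
Qed.

Lemma le_funepos_funeneg (f g : T -> R) (x : T) : (`|f x| <= g x)%R ->
  (EFin \o f)^\+ x <= (g x)%:E /\ (EFin \o f)^\- x <= (g x)%:E.
Proof.
move=> fg; have g0 : (0 <= g x)%R by rewrite (le_trans _ fg).
move: fg; rewrite ler_norml lerNl => /andP[h1 h2].
by rewrite funeposE funenegE /= -!EFin_max !lee_fin !ge_max h1 h2 g0.
Qed.

Lemma ge0_lower_integral_fin (f : T -> \bar R) (g : T -> R) (c : R) :
  (forall x, 0 <= f x) -> (forall x, f x <= (g x)%:E) ->
  \int[mu]_x (g x)%:E <= c%:E ->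
  exists2 r : R, \int[mu]_x f x = r%:E & (0 <= r <= c)%R.
Proof.
move=> f0 fg gc.
have a0 : 0 <= \int[mu]_x f x by exact: integral_ge0.
have ac : \int[mu]_x f x <= c%:E.
  by apply: le_trans gc; exact: ge0_le_lower_integral.
have fi : \int[mu]_x f x \is a fin_num.
  by rewrite ge0_fin_numE// (le_lt_trans ac) ?ltry.
exists (fine (\int[mu]_x f x)); first by rewrite fineK.
by rewrite -!lee_fin fineK// a0.
Qed.

(** The integral is by definition the difference of those of the positive and negative parts, and
    both of these lie in [[0, c]]. *)
Lemma lower_integral_bounded (f g : T -> R) (c : R) :
  (forall x, `|f x| <= g x)%R -> \int[mu]_x (g x)%:E <= c%:E ->
  exists2 r : R, \int[mu]_x (f x)%:E = r%:E & (`|r| <= c)%R.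
Proof.
move=> fg gc; have h x := le_funepos_funeneg (fg x).
have [p pE p0c] := ge0_lower_integral_fin (funepos_ge0 (EFin \o f))
  (fun x => (h x).1) gc.
have [n nE n0c] := ge0_lower_integral_fin (funeneg_ge0 (EFin \o f))
  (fun x => (h x).2) gc.
exists (p - n)%R; first by rewrite integralE pE nE.
by rewrite ler_norml; lra.
Qed.

(** The majorant [g] makes the integrals of all positive and negative parts finite, while [k]
    controls the discrepancy off [A]. Each of the two parts contributes at most [c], hence the
    factor 2. *)
Lemma dist_Rintegral_le (A : set T) (f1 f2 g k : T -> R) (G c : R) :
  measurable A ->
  (forall x, `|f1 x| <= g x)%R -> (forall x, `|f2 x| <= g x)%R ->
  \int[mu]_x (g x)%:E <= G%:E ->
  (forall x, A x -> f1 x = f2 x) ->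
  (forall x, ~ A x -> `|f1 x| <= k x)%R ->
  (forall x, ~ A x -> `|f2 x| <= k x)%R ->
  (forall x, 0 <= k x)%R -> \int[mu]_x (k x)%:E <= c%:E ->
  (`|\int[mu]_x f1 x - \int[mu]_x f2 x| <= 2 * c)%R.
Proof.
move=> mA g1 g2 gG f12 k1 k2 k0 kc.
have h1 x := le_funepos_funeneg (g1 x); have h2 x := le_funepos_funeneg (g2 x).
have l1 x Ax := le_funepos_funeneg (k1 x Ax).
have l2 x Ax := le_funepos_funeneg (k2 x Ax).
have [p1 p1E _] := ge0_lower_integral_fin (funepos_ge0 (EFin \o f1))
  (fun x => (h1 x).1) gG.
have [n1 n1E _] := ge0_lower_integral_fin (funeneg_ge0 (EFin \o f1))
  (fun x => (h1 x).2) gG.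
have [p2 p2E _] := ge0_lower_integral_fin (funepos_ge0 (EFin \o f2))
  (fun x => (h2 x).1) gG.
have [n2 n2E _] := ge0_lower_integral_fin (funeneg_ge0 (EFin \o f2))
  (fun x => (h2 x).2) gG.
(* One-sided comparison, applied below to both parts and in both orders. *)
have step (u v : T -> \bar R) (a b : R) : (forall x, 0 <= u x) ->
    (forall x, 0 <= v x) -> (forall x, A x -> u x = v x) ->
    (forall x, ~ A x -> u x <= (k x)%:E) ->
    \int[mu]_x u x = a%:E -> \int[mu]_x v x = b%:E -> (a <= b + c)%R.
  move=> u0 v0 uv uk ua vb.
  rewrite -lee_fin EFinD -ua -vb.
  by apply: (le_trans (lower_integral_le_add mA u0 v0 _ uv uk)) => //; exact: leeD.
have e x : A x -> (EFin \o f1)^\+ x = (EFin \o f2)^\+ x /\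
    (EFin \o f1)^\- x = (EFin \o f2)^\- x.
  by move=> Ax; rewrite !funeposE !funenegE /= f12.
have := step _ _ _ _ (funepos_ge0 _) (funepos_ge0 _) (fun x Ax => (e x Ax).1)
  (fun x Ax => (l1 x Ax).1) p1E p2E.
have := step _ _ _ _ (funepos_ge0 _) (funepos_ge0 _)
  (fun x Ax => esym (e x Ax).1) (fun x Ax => (l2 x Ax).1) p2E p1E.
have := step _ _ _ _ (funeneg_ge0 _) (funeneg_ge0 _) (fun x Ax => (e x Ax).2)
  (fun x Ax => (l1 x Ax).2) n1E n2E.
have := step _ _ _ _ (funeneg_ge0 _) (funeneg_ge0 _)
  (fun x Ax => esym (e x Ax).2) (fun x Ax => (l2 x Ax).2) n2E n1E.
rewrite /Rintegral (integralE _ _ (EFin \o f1)) p1E n1E.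
rewrite (integralE _ _ (EFin \o f2)) p2E n2E /= ler_norml.
by move=> *; lra.
Qed.

End lower_integral.

(** * Uniform bounds on the payoff, the value and [Q] *)

Section bounded_payoff.
Context {R : realType} (m : market R).
Hypothesis hbuy : 0 <= buy_cost m.
Hypothesis hsell : 0 <= sell_cost m < 1.
Hypothesis hrisk : 0 < risk_av m.

Lemma liquidation_mono (S : R) : 0 < S ->
  {homo liquidation m ^~ S : y y' / y <= y'}.
Proof.
move=> S0 y y' yy'; have /andP[s0 s1] := hsell.
have b := hbuy.
have a0 : 0 <= (1 - sell_cost m) * S by rewrite mulr_ge0; lra.
have b0 : 0 <= (1 + buy_cost m) * S by rewrite mulr_ge0; lra.
rewrite /liquidation; case: ifPn => y0; case: ifPn => y'0; try nra.
all: lra.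
Qed.

(** At maturity the compounding factor in [region] is 1. The region is stated for [y - 1] shares, so
    passing to [y] can only raise the liquidation value; for the writer with [S >= strike m], the
    strike received is positive. *)
Lemma terminal_wealth_gt (j : position) (E X y S : R) : 0 < strike m ->
  region m E (maturity m) (X, y, S) -> - E < terminal_wealth m j X y S.
Proof.
move=> K0 [/= S0]; rewrite subrr mulr0 expR0 mulr1 => h.
have : liquidation m (y - 1) S <= liquidation m y S.
  by apply: liquidation_mono => //; lra.
by case: j => /=; [|case: ifPn => _]; lra.
Qed.

Lemma residual_utility_le (E : R) : 0 < E ->
  `|residual_utility m E| <= expR (risk_av m * E).
Proof.
move=> E0; rewrite /residual_utility.
have : 1 <= expR (risk_av m * E) by rewrite -expR0 ler_expR mulr_ge0// ltW.
by rewrite ler_norml; lra.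
Qed.

Lemma utility_le (E x : R) : 0 < E -> - E < x ->
  `|utility m x| <= expR (risk_av m * E).
Proof.
move=> E0 Ex; rewrite /utility.
have : 1 <= expR (risk_av m * E) by rewrite -expR0 ler_expR mulr_ge0// ltW.
have : expR (- (risk_av m * x)) <= expR (risk_av m * E) 
  by rewrite ler_expR -mulrN ler_pM2l//; lra.
have := expR_gt0 (- (risk_av m * x)).
by rewrite ler_norml; lra.
Qed.

Context {d : measure_display} {Omega : measurableType d}.
Variables (P : probability Omega R) (F : R -> set (set Omega)).
Variable z : R -> Omega -> R.
Hypothesis hK : 0 < strike m.

Lemma payoff_le (j : position) (E t : R) (X Y S : R -> Omega -> R) (w : Omega) :
  0 < E -> t <= maturity m ->
  `|payoff m j E t X Y S w| <= expR (risk_av m * E).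
Proof.
move=> E0 tT; rewrite /payoff; case: asboolP => [h|_].
  (* Not being expelled is used at the final time [maturity m]. *)
  by apply/utility_le/terminal_wealth_gt => //; apply: h; rewrite tT lexx.
exact: residual_utility_le.
Qed.

Lemma value_le (j : position) (E t x y s : R) : 0 < E -> t <= maturity m ->
  `|fine (value P m F z j E t x y s)| <= expR (risk_av m * E).
Proof.
move=> E0 tT; set M := expR _.
rewrite /value; case: ifPn => _; last exact: residual_utility_le.
set A := expected_utilities _ _ _ _ _ _ _ _ _ _.
have bnd e : A e -> ((- M)%:E <= e <= M%:E)%E.
  move=> [L [M' [X [Y [S [_ _ _ ->]]]]]]; rewrite unlock.
  have [||r -> rM] := @lower_integral_bounded _ _ _ P
    (payoff m j E t X Y S) (cst M) M.
  - by move=> w; exact: payoff_le.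
  - by rewrite -[leLHS]/(\int[P]_w cst M%:E w)%E integral_cst//= probability_setT mule1.
  - by rewrite !lee_fin -ler_norml.
(* If [A] is empty its supremum is [-oo], which [fine] sends to 0. *)
have [->|/set0P[e Ae]] := eqVneq A set0.
  by rewrite ereal_sup0 /= normr0 expR_ge0.
have : (ereal_sup A <= M%:E)%E.
  by apply: ge_ereal_sup => e' /bnd /andP[].
have : ((- M)%:E <= ereal_sup A)%E.
  by apply: le_trans (ereal_sup_ubound Ae); have /andP[] := bnd _ Ae.
by case: ereal_sup => //= r; rewrite !lee_fin ler_norml => -> ->.
Qed.

(** Neither the divisor [D] nor the bound on the value involves [s], so one [C] serves all
    prices. *)
Lemma Q_bounded (j : position) (E x t y : R) : 0 < E -> t <= maturity m ->
  exists2 C : R, 0 < C & forall s, `|Q P m F z j E x t y s| <= C.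
Proof.
move=> E0 tT; set D := expR (- (risk_av m * (x / discount m t))).
have D0 : 0 < D := expR_gt0 _.
exists ((1 + expR (risk_av m * E)) / D).
  by rewrite divr_gt0// addr_gt0// expR_gt0.
move=> s; rewrite /Q -/D normrM normfV (gtr0_norm D0) ler_pM2r ?invr_gt0//.
by rewrite (le_trans (ler_normB _ _))// normr1 lerD2l; exact: value_le.
Qed.

End bounded_payoff.

(** The odd reflection [2 * phi a - phi (2 * a - x)] costs the factor 3; the even reflection and the
    translation only move the argument. *)
Lemma periodic_ext_bounded {R : realType} (phi : R -> R) (a C x : R) :
  (forall y, `|phi y| <= C) -> `|periodic_ext phi a x| <= 3 * C.
Proof.
move=> h; have C0 : 0 <= C by rewrite (le_trans _ (h 0)).
have o y : `|odd_ext phi a y| <= 3 * C.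
  rewrite /odd_ext; case: ifPn => _; first by rewrite (le_trans (h y)); lra.
  by have := h a; have := h (2 * a - y); rewrite !ler_norml; lra.
by rewrite /periodic_ext /even_ext; case: ifPn.
Qed.

(** * Gaussian decay of the kernel and of its tails *)

Section gaussian_estimates.
Context {R : realType}.

(** The integrand is a multiple of the centred normal density of variance [1 / (2 * kappa)]. *)
Lemma integral_gaussian (kappa : R) : 0 < kappa -> exists2 G : R, 0 < G &
  forall K : R,
  (\int[lebesgue_measure]_(y in [set: R]) (K * expR (- (kappa * y ^+ 2)))%:E
   = (K * G)%:E)%E.
Proof.
move=> k0; set s : R := Num.sqrt ((2 * kappa)^-1).
have k20 : 0 < (2 * kappa)^-1 by rewrite invr_gt0; lra.
have s0 : s != 0 by rewrite gt_eqF// sqrtr_gt0.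
have p0 : 0 < normal_peak s by exact: normal_peak_gt0.
exists (normal_peak s)^-1; first by rewrite invr_gt0.
move=> K.
under eq_integral => y _.
  have -> : K * expR (- (kappa * y ^+ 2))
      = K * (normal_peak s)^-1 * normal_pdf 0 s y.
    rewrite normal_pdfE// -mulrA [X in _ = _ * X]mulrA mulVf ?gt_eqF// mul1r.
    congr (_ * expR _); rewrite sqr_sqrtr ?ltW// subr0.
    by field; rewrite gt_eqF.
  rewrite EFinM; over.
rewrite integralZl//; last exact: integrable_normal_pdf.
by rewrite integral_normal_pdf mule1.
Qed.

(* Completing the square: [(y - b)^2 >= y^2 / 2 - b^2], and [b] stays bounded
   when [x] does. *)
Lemma Theta_gaussian_bound (m : market R) (L t t0 : R) : 0 < vol m -> t < t0 ->
  exists c kappa : R, [/\ 0 < c, 0 < kappa & forall x y : R, - L <= x <= L ->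
    0 <= Theta m y x t t0 <= c * expR (- (kappa * y ^+ 2))].
Proof.
move=> v0 tt0; set tau := t0 - t; have tau0 : 0 < tau by rewrite subr_gt0.
set c0 := (vol m * Num.sqrt (2 * pi * tau))^-1.
have c00 : 0 < c0.
  by rewrite invr_gt0 mulr_gt0// sqrtr_gt0 mulr_gt0// mulr_gt0// pi_gt0.
set w := (drift m - vol m ^+ 2 / 2) * tau.
set q := 2 * vol m ^+ 2 * tau.
have q0 : 0 < q by rewrite !mulr_gt0.
set B := `|L| + `|w|.
exists (c0 * expR (B ^+ 2 / q)), (2 * q)^-1; split.
- by rewrite mulr_gt0// expR_gt0.
- by rewrite invr_gt0 mulr_gt0.
move=> x y xL; rewrite /Theta -/tau -/c0 -/w -/q.
rewrite mulr_ge0 ?expR_ge0 ?(ltW c00)//=.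
rewrite -[leRHS]mulrA ler_pM2l// -expRD ler_expR.
have bB : `|x + w| <= B.
  rewrite (le_trans (ler_normD _ _))// lerD2r.
  by rewrite (le_trans _ (ler_norm L))// ler_norml.
have b2 : (x + w) ^+ 2 <= B ^+ 2.
  by rewrite -(real_normK (num_real (x + w))) lerXn2r ?nnegrE ?addr_ge0.
rewrite -subr_ge0.
have -> : B ^+ 2 / q - (2 * q)^-1 * y ^+ 2 - - ((y - (x + w)) ^+ 2 / q)
   = (B ^+ 2 - y ^+ 2 / 2 + (y - (x + w)) ^+ 2) / q.
  by field; rewrite gt_eqF.
rewrite divr_ge0 ?(ltW q0)//.
(* With [b = x + w], half of this square is exactly [(y - b)^2 - y^2 / 2 + b^2]. *)
have := sqr_ge0 (y - 2 * (x + w)).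
move: b2; rewrite !expr2; move: (x + w) => b; lra.
Qed.

(** The Gaussian exponent is halved: off [[- a, a]] one half is bounded by its value at [a] and
    gives the small factor, and the other half stays integrable. [D] and [kappa] are chosen before
    [a], the data and [x], so they also serve data that vary with [a]. *)
Lemma dist_parabolic_solution_le (m : market R) (L t t0 M : R) :
  0 < vol m -> t < t0 -> 0 < M ->
  exists D kappa : R, [/\ 0 < D, 0 < kappa &
    forall (psi1 psi2 : R -> R) (a : R), 0 <= a ->
      (forall y, `|psi1 y| <= M) -> (forall y, `|psi2 y| <= M) ->
      (forall y, - a <= y <= a -> psi1 y = psi2 y) ->
      forall x, - L <= x <= L ->
      `|parabolic_solution m psi1 t0 x t - parabolic_solution m psi2 t0 x t|
        <= D * expR (- (kappa * a ^+ 2))].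
Proof.
move=> v0 tt0 M0.
have [c [kap [c0 kap0 Th]]] := Theta_gaussian_bound L v0 tt0.
have kap20 : 0 < kap / 2 by lra.
have [G1 G10 G1E] := integral_gaussian kap0.
have [G2 G20 G2E] := integral_gaussian kap20.
exists (2 * (M * c * G2)), (kap / 2); split=> //; first by rewrite !mulr_gt0.
move=> psi1 psi2 a a0 b1 b2 e x xL; rewrite /parabolic_solution tt0.
have g (psi : R -> R) : (forall y, `|psi y| <= M) -> forall y,
    `|psi y * Theta m y x t t0| <= M * c * expR (- (kap * y ^+ 2)).
  move=> b y; have /andP[T0 T1] := Th x y xL.
  by rewrite normrM (ger0_norm T0) -mulrA ler_pM.
have k (psi : R -> R) : (forall y, `|psi y| <= M) -> forall y, ~ `[- a, a]%classic y ->
    `|psi y * Theta m y x t t0|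
    <= M * c * expR (- (kap / 2 * a ^+ 2)) * expR (- (kap / 2 * y ^+ 2)).
  move=> b y ya; apply: (le_trans (g _ b y)).
  rewrite -[leRHS]mulrA ler_pM2l ?mulr_gt0// -expRD ler_expR.
  have : a ^+ 2 <= y ^+ 2.
    move: ya; rewrite /= in_itv /= => /negP; rewrite negb_and -!ltNge !expr2.
    by case/orP=> ?; nra.
  nra.
rewrite (_ : 2 * _ * _ = 2 * (M * c * expR (- (kap / 2 * a ^+ 2)) * G2)); last by ring.
apply: (@dist_Rintegral_le _ _ _ lebesgue_measure `[- a, a]%classic
  (fun y => psi1 y * Theta m y x t t0) (fun y => psi2 y * Theta m y x t t0)
  _ _ (M * c * G1) _ _ (g _ b1) (g _ b2) _ _ (k _ b1) (k _ b2)).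
- exact: measurable_itv.
- by rewrite G1E.
- by move=> y; rewrite /= in_itv /= => /e ->.
- by move=> y; rewrite !mulr_ge0 ?expR_ge0// ltW.
- by rewrite G2E.
Qed.

End gaussian_estimates.

(** * Choice of the threshold [xeps] *)

Theorem theorem4p3 (R : realType) (d : measure_display)
  (Omega : measurableType d) (P : probability Omega R)
  (F : R -> set (set Omega)) (z : R -> Omega -> R) (m : market R)
  (hF : filtration F) (hz : brownian P F z)
  (hvol : 0 < vol m) (hbuy : 0 <= buy_cost m)
  (hsell : 0 <= sell_cost m < 1) (hrisk : 0 < risk_av m)
  (hT : 0 < maturity m) (hK : 0 < strike m)
  (j : position) (E0 X0 y0 t0 : R) (hE0 : 0 < E0)
  (ht0 : 0 <= t0 <= maturity m)
  (L t : R) (hL : 0 < L) (ht : t <= t0) :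
  let phi := fun x : R => Q P m F z j E0 X0 t0 y0 (expR x) in
  forall eps : R, 0 < eps ->
  exists2 xeps : R, 0 < xeps &
    forall xstar : R, xeps <= xstar ->
    forall x : R, - L <= x <= L ->
      `|parabolic_solution m (periodic_ext phi xstar) t0 x t
        - parabolic_solution m phi t0 x t| <= eps.
Proof.
move=> phi eps eps0; have /andP[_ t0T] := ht0.
have [C C0 CQ] := Q_bounded hbuy hsell hrisk P F z hK j X0 y0 hE0 t0T.
have phiC y : `|phi y| <= C by exact: CQ.
have phi3C y : `|phi y| <= 3 * C by rewrite (le_trans (phiC y)); lra.
move: ht; rewrite le_eqVlt => /predU1P[->|tt0].
  (* At [t = t0] the solutions are the data themselves, which agree on [[- a, a]], and this contains
     [[- L, L]]. *)
  exists L => // a La x xL; rewrite /parabolic_solution ltxx.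
  have [a0 xa] : 0 < a /\ - a <= x <= a by move: hL; lra.
  by rewrite periodic_ext_id// subrr normr0 ltW.
have C30 : 0 < 3 * C by lra.
have [D [kappa [D0 k0 Dle]]] := dist_parabolic_solution_le L hvol tt0 C30.
have e0 : 0 < D / (kappa * eps) by rewrite divr_gt0 ?mulr_gt0.
(* Since [exp u >= 1 + u], the bound [D exp(- kappa a^2) <= eps] holds once [kappa a^2 >= D / eps].
   The summand 1 ensures [a >= 1], hence [a^2 >= a], and [kappa a >= D / eps] suffices. *)
exists (1 + D / (kappa * eps)) => [|a aD x xL]; first by lra.
have a0 : 0 < a by lra.
apply: le_trans (Dle _ _ _ (ltW a0) _ phi3C _ _ xL) _ => [y|y ya|].
- exact: periodic_ext_bounded.
- by rewrite periodic_ext_id.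
rewrite expRN ler_pdivrMr ?expR_gt0// mulrC -ler_pdivrMr//.
apply: le_trans (expR_ge1Dx _).
have Da : D / eps <= kappa * a.
  have -> : D / eps = kappa * (D / (kappa * eps)) by field; rewrite !gt_eqF.
  by rewrite ler_pM2l//; lra.
have : kappa * a <= kappa * a ^+ 2.
  by rewrite ler_pM2l// expr2 ler_peMr ?ltW//; lra.
lra.
Qed.
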